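(* Let $f(x),g(x)\in\mathbb{Z}[x]$ be non-zero polynomials. Then, for every choice of pairwise distinct primes made during its execution, the procedure BPN described in the context terminates after finitely many steps and outputs a greatest common divisor of $f(x)$ and $g(x)$ in $\mathbb{Z}[x]$.
   Context: Notation. For a non-zero polynomial $u(x)=u_0x^n+\cdots+u_n\in\mathbb{Z}[x]$ with $u_0\neq0$: $\mathrm{lc}(u)=u_0$; $\|u\|=\sqrt{\sum_{i=0}^n u_i^2}$; $\mathrm{cont}(u)$ is the gcd of the coefficients, with sign chosen equal to the sign of $\mathrm{lc}(u)$; $\mathrm{pp}(u)=u/\mathrm{cont}(u)$. Greatest common divisors in $\mathbb{Z}[x]$ are defined up to sign. For a prime $p$, $u_p(x)\in\mathbb{Z}_p[x]$ is the coefficientwise reduction of $u$ modulo $p$, where $\mathbb{Z}_p=\{0,\dots,p-1\}$ is the field of residues modulo $p$. Reconstruction: for $v(x)\in\mathbb{Z}_p[x]$, its reconstructed pre-image is the polynomial in $\mathbb{Z}[x]$ obtained by replacing each coefficient $b\in\{0,\dots,p-1\}$ of $v$ by $b$ if $b<p/2$ and by $b-p$ otherwise. Procedure BPN on input $f,g$: (1) Set $r=\gcd(\mathrm{cont}(f),\mathrm{cont}(g))\in\mathbb{Z}$, and replace $f$ by $\mathrm{pp}(f)$ and $g$ by $\mathrm{pp}(g)$. (2) Set $a_0=\mathrm{lc}(f)>0$, $b_0=\mathrm{lc}(g)>0$, $w=\gcd(a_0,b_0)>0$. (3) Set $D=\min\{\deg f,\deg g\}+1$ and $$N_{f,g}=2^{\min\{\deg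 f,\deg g\}}\cdot w\cdot\min\left\{\frac{\|f\|}{a_0},\frac{\|g\|}{b_0}\right\}.$$ (4) Choose a new prime $p>2N_{f,g}$ (different from all primes chosen before). Compute a gcd $e_p(x)$ of $f_p(x),g_p(x)$ in $\mathbb{Z}_p[x]$ by the Euclidean algorithm. (5) If $D\le\deg e_p(x)$, go to (4). (6) Otherwise choose $t\in\mathbb{Z}_p$ with $\mathrm{lc}(t\cdot e_p(x))=w$ in $\mathbb{Z}_p$, let $k(x)\in\mathbb{Z}[x]$ be the reconstructed pre-image of $t\cdot e_p(x)$, and set $d(x)=\mathrm{pp}(k(x))$. (7) If $d(x)\mid f(x)$ and $d(x)\mid g(x)$ in $\mathbb{Z}[x]$, output $r\cdot d(x)$ and stop. Otherwise set $D=\deg e_p(x)$ and go to (4). *)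

(* Defs.v *)
From HB Require Import structures.
From Stdlib Require Import Relations.
From mathcomp Require Import all_boot all_order all_algebra.
Set Implicit Arguments.
Unset Strict Implicit.
Unset Printing Implicit Defensive.
Import Order.TTheory GRing.Theory Num.Theory.
Local Open Scope ring_scope.

(* [%|] on [{poly int}] is pseudo-divisibility, which ignores nonzero constant
   factors (2 would divide 1), so divisibility in Z[x] is spelled out. *)
Definition dvdZX (d u : {poly int}) : Prop := exists q : {poly int}, u = q * d.

Definition is_gcdZX (h f g : {poly int}) : Prop :=
  [/\ dvdZX h f, dvdZX h g &
      forall d : {poly int}, dvdZX d f -> dvdZX d g -> dvdZX d h].

Definition deg (A : nzRingType) (u : {poly A}) : nat := (size u).-1.

Definition norm2 (R : rcfType) (u : {poly int}) : R :=
  Num.sqrt (\sum_(i < size u) (u`_i)%:~R ^+ 2).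

Definition lc_gcd (f g : {poly int}) : int :=
  gcdz (lead_coef f) (lead_coef g).

Definition coef_bound (R : rcfType) (f g : {poly int}) : R :=
  2 ^+ minn (deg f) (deg g) * (lc_gcd f g)%:~R *
  Num.min (norm2 R f / (lead_coef f)%:~R) (norm2 R g / (lead_coef g)%:~R).

Definition modp (p : nat) (u : {poly int}) : {poly 'F_p} :=
  map_poly (intr : int -> 'F_p) u.

(* For p prime the elements of ['F_p] are the ordinals 0, ..., p - 1. *)
Definition sym_residue (p : nat) (b : 'F_p) : int :=
  let n := nat_of_ord b in if (n.*2 < p)%N then n%:Z else n%:Z - p%:Z.

Definition reconstruct (p : nat) (v : {poly 'F_p}) : {poly int} :=
  map_poly (@sym_residue p) v.

(* The procedure is a nondeterministic transition system, so that a choice that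
   cannot be made shows up as a configuration without successor.  [D] is the
   current degree bound and [used] the list of the primes chosen so far. *)
Inductive config : Type :=
  | ChoosePrime (D : nat) (used : seq nat)
  | CompareDegree (D : nat) (used : seq nat) (p : nat) (e : {poly 'F_p})
  | Normalize (used : seq nat) (p : nat) (e : {poly 'F_p})
  | TrialDivide (m : nat) (used : seq nat) (d : {poly int})
  | Output (h : {poly int}).

Definition bpn_start (f g : {poly int}) : config :=
  ChoosePrime (minn (deg (zprimitive f)) (deg (zprimitive g))).+1 [::].

(* [gcdp] and [%=] are over the field ['F_p]: [e] is an arbitrary gcd of the
   reductions.  In [TrialDivide], [m] is the degree of the modular gcd, which
   becomes the new bound when the division fails. *)
Definition bpn_step (R : rcfType) (f g : {poly int}) (c c' : config) : Prop :=
  let r := gcdz (zcontents f) (zcontents g) in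
  let f1 := zprimitive f in
  let g1 := zprimitive g in
  match c with
  | ChoosePrime D used =>
      exists (p : nat) (e : {poly 'F_p}),
        [/\ prime p, p \notin used, 2 * coef_bound R f1 g1 < p%:R,
            e %= gcdp (modp p f1) (modp p g1) &
            c' = CompareDegree D (p :: used) e]
  | CompareDegree D used p e =>
      c' = if (D <= deg e)%N then ChoosePrime D used else Normalize used e
  | Normalize used p e =>
      exists t : 'F_p,
        lead_coef (t *: e) = (lc_gcd f1 g1)%:~R /\
        c' = TrialDivide (deg e) used (zprimitive (reconstruct (t *: e)))
  | TrialDivide m used d =>
      (dvdZX d f1 /\ dvdZX d g1) /\ c' = Output (r *: d) \/
      ~ (dvdZX d f1 /\ dvdZX d g1) /\ c' = ChoosePrime m used
  | Output _ => False
  end.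

Definition bpn_reachable (R : rcfType) (f g : {poly int}) : config -> Prop :=
  clos_refl_trans config (bpn_step R f g) (bpn_start f g).

(* Main.v *)
From Stdlib Require Import Relations.
From mathcomp Require Import all_boot all_order all_algebra all_field.
From mathcomp Require Import ring zify.
Require Import Defs.
Set Implicit Arguments.
Unset Strict Implicit.
Unset Printing Implicit Defensive.
Import Order.TTheory GRing.Theory Num.Theory.
Local Open Scope ring_scope.

(** Write [f1], [g1] for the primitive parts of [f], [g], let [h] be their
    primitive gcd and [w] the gcd of their leading coefficients, and let [p] be
    an admissible prime, that is, one above twice the coefficient bound.

    Since the coefficient bound is at least [w] ([lc_gcd_le_coef_bound]), the
    prime [p] does not divide [lc h], a divisor of [w].  So [h] keeps its degree
    modulo [p], divides the modular gcd [e], and [deg h <= deg e]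
    ([size_primitive_gcd_le]).  In this proof [p] is called lucky when the
    degrees agree, and unlucky otherwise.

    - If [p] is lucky, the normalised modular gcd is the reduction of
      [(w / lc h) h] ([lucky_prime_scaled]).  By the Landau-Mignotte inequality
      ([mignotte]) the coefficients of that polynomial are smaller than [p / 2]
      in absolute value, so reconstruction gives it back, its primitive part is
      [h], and the trial division succeeds ([lucky_candidate]).
    - If [p] is unlucky, the candidate has a degree larger than that of [h], so
      it cannot divide both [f1] and [g1]; the new bound is still larger than
      [deg h].
    - A candidate that is accepted divides [h] and has at least its degree, so it
      is [h] ([accepted_candidate]).  Gauss's lemma turns this into the gcd of
      [f] and [g] ([is_gcdZX_contents]).

    Thus [deg h < D] whenever a prime is about to be chosen ([bpn_inv]), and a
    lucky prime is never discarded by the degree test.  An unlucky prime divides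
    the constant [c] of a Bezout identity [c h = u f1 + v g1]
    ([unlucky_prime_dvd]), so there are finitely many of them, and the number of
    those not chosen yet gives a measure that decreases at each step
    ([bpn_measure_step]).  Finally, every configuration that satisfies the
    invariant, except an output, has a successor ([bpn_progress]): primes are
    infinite in number and the coefficient bound is below some natural number. *)

(** * The Landau-Mignotte inequality *)

Definition sqnorm (C : numDomainType) (p : {poly C}) : C :=
  \sum_(i < size p) `|p`_i| ^+ 2.

(** The product of this factor over the roots of a monic polynomial is its
    Mahler measure. *)
Definition max1norm (C : numDomainType) (z : C) : C :=
  if `|z| <= 1 then 1 else `|z|.

Lemma sqnorm_widen (C : numDomainType) (p : {poly C}) n :
  (size p <= n)%N -> sqnorm p = \sum_(0 <= i < n) `|p`_i| ^+ 2.
Proof.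
move=> le_pn; rewrite /sqnorm big_mkord (big_ord_widen n (fun i => `|p`_i| ^+ 2) le_pn).
rewrite [RHS](bigID (fun i : 'I_n => (i < size p)%N)) /= [X in _ = _ + X]big1 ?addr0 // => i.
by rewrite -leqNgt => /leq_sizeP/(_ _ (leqnn _))->; rewrite normr0 expr0n.
Qed.

Lemma max1norm_ge1 (C : numFieldType) (z : C) : 1 <= max1norm z.
Proof.
rewrite /max1norm; case: ifP => // /negbT.
by rewrite -real_ltNge ?normr_real ?real1 // => /ltW.
Qed.

Lemma normr_le_max1norm (C : numFieldType) (z : C) : `|z| <= max1norm z.
Proof. by rewrite /max1norm; case: ifP. Qed.

(** Replacing a root [z] by its mirror image in the unit circle keeps the norm:
    index by index, the difference of the two sides is
    [(|z|^2 - 1) (|q_i|^2 - |q_{i-1}|^2)], which telescopes to zero. *)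
Lemma sqnorm_reflect_root (C : numClosedFieldType) (z : C) (q : {poly C}) :
  sqnorm (q * ('X - z%:P)) = sqnorm (q * (z^* *: 'X - 1)).
Proof.
have sz (u : {poly C}) : (size u <= 2)%N -> (size (q * u)%R <= (size q).+1)%N.
  by move=> su; apply: (leq_trans (size_polyMleq _ _)); move: su; lia.
rewrite (sqnorm_widen (sz _ _)); last by rewrite size_XsubC.
rewrite (sqnorm_widen (sz _ _)); last first.
  rewrite (leq_trans (size_polyD _ _)) // geq_max size_polyN size_poly1 andbT.
  by rewrite (leq_trans (size_scale_leq _ _)) ?size_polyX.
apply/eqP; rewrite -subr_eq0 -sumrB.
pose b i := (`|z| ^+ 2 - 1) * `|('X * q)`_i| ^+ 2.
rewrite (eq_bigr (fun i => b i.+1 - b i)) => [|i _].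
  rewrite telescope_sumr // /b !coefXM /= nth_default ?leqnn //.
  by rewrite normr0 expr0n !mulr0 subrr.
rewrite /b [X in _ * `|X| ^+ 2 - _]coefXM /=.
have -> : q * ('X - z%:P) = 'X * q - z *: q by rewrite -mul_polyC; ring.
have -> : q * (z^* *: 'X - 1) = z^* *: ('X * q) - q by rewrite -!mul_polyC; ring.
rewrite !coefB !coefZ !normCK !rmorphB !rmorphM /= !conjCK; ring.
Qed.

(** Landau's inequality.  The roots of modulus above [1] are reflected one after
    the other; each reflection keeps the norm and multiplies the leading
    coefficient by the modulus of the root.  The cofactor [q] absorbs the factors
    already treated, and makes the bound apply to the roots of a divisor only. *)
Lemma landau (C : numClosedFieldType) (rs : seq C) (q : {poly C}) :
  `|lead_coef q| ^+ 2 * \prod_(z <- rs) max1norm z ^+ 2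
    <= sqnorm (q * \prod_(z <- rs) ('X - z%:P)).
Proof.
elim: rs q => [|z rs IH] q.
  rewrite !big_nil !mulr1; have [->|nz_q] := eqVneq q 0.
    rewrite lead_coef0 normr0 expr0n; apply: sumr_ge0 => i _; exact: exprn_ge0.
  have q_gt0 : (0 < size q)%N by rewrite size_poly_gt0.
  rewrite /sqnorm lead_coefE -{1}(prednK q_gt0).
  case: (size q) q_gt0 => // n _.
  rewrite big_ord_recr /= ler_wpDl //.
  by apply: sumr_ge0 => i _; rewrite exprn_ge0.
rewrite !big_cons mulrA [q * (_ * _)]mulrA; case: (boolP (`|z| <= 1)) => hz.
  have := IH (q * ('X - z%:P)).
  by rewrite lead_coefM lead_coefXsubC mulr1 {2}/max1norm hz expr1n mulr1.
have nz_z : z != 0 by apply: contraNneq hz => ->; rewrite normr0 ler01.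
have := IH (q * (z^* *: 'X - 1)).
rewrite lead_coefM (_ : lead_coef (z^* *: 'X - 1) = z^*); last first.
  by rewrite lead_coefDl ?lead_coefZ ?lead_coefX ?mulr1 // size_scale ?conjC_eq0 //
    size_polyN size_poly1 size_polyX.
rewrite normrM norm_conjC exprMn {2}/max1norm (negPf hz) => /le_trans; apply.
by rewrite (mulrAC q ('X - _)) sqnorm_reflect_root mulrAC.
Qed.

(** Pascal's rule: multiplying by ['X - z] turns a coefficient into a difference
    of two neighbours, one of them scaled by [z]. *)
Lemma coef_prod_XsubC_le (C : numClosedFieldType) (rs : seq C) (i : nat) :
  `|(\prod_(z <- rs) ('X - z%:P))`_i|
    <= 'C(size rs, i)%:R * \prod_(z <- rs) max1norm z.
Proof.
elim: rs i => [|z rs IH] i.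
  rewrite !big_nil mulr1 coef1 bin0n; case: i => [|i] /=; by rewrite ?normr1 ?normr0.
rewrite !big_cons mulrBl mul_polyC coefB coefXM coefZ.
set P := \prod_(_ <- _) (_ - _) in IH *.
set M := \prod_(_ <- _) max1norm _ in IH *.
have M0 : 0 <= M.
  by apply: prodr_ge0 => x _; apply: le_trans (max1norm_ge1 x).
have m1 := max1norm_ge1 z; have m2 := normr_le_max1norm z.
have ge0 n j : 0 <= 'C(n, j)%:R * M by rewrite mulr_ge0.
have m0 := le_trans ler01 m1.
have zP : `|z * P`_i| <= 'C(size rs, i)%:R * (max1norm z * M).
  by rewrite normrM mulrCA ler_pM.
apply: (le_trans (ler_normB _ _)); case: i zP => [|i] zP /=.
  by rewrite normr0 add0r bin0 -(bin0 (size rs)).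
rewrite binS natrD mulrDl addrC lerD // (le_trans (IH i)) //.
by rewrite mulrCA ler_peMl.
Qed.

Lemma bin_le_exp2 n i : ('C(n, i) <= 2 ^ n)%N.
Proof.
elim: n i => [|n IH] [|i]; rewrite ?bin0 ?expn_gt0 //.
by rewrite binS expnS mul2n -addnn leq_add.
Qed.

(** The statement is squared to stay among the integers, so that the proof over
    the algebraic numbers yields it in any real closed field. *)
Lemma mignotte (h f : {poly int}) (i : nat) :
  h != 0 -> dvdZX h f ->
  (h`_i * lead_coef f) ^+ 2
    <= (2 ^+ deg h * lead_coef h) ^+ 2 * \sum_(j < size f) f`_j ^+ 2.
Proof.
move=> nz_h [q fE].
have sqZ (a : int) : (a ^+ 2)%:~R = `|a%:~R : algC| ^+ 2.
  by rewrite real_normK ?realz // rmorphXn.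
pose toC := map_poly (intr : int -> algC).
have szC u : size (toC u) = size u.
  have [->|nz_u] := eqVneq u 0; first by rewrite /toC rmorph0 !size_poly0.
  by rewrite size_map_poly_id0 // intr_eq0 lead_coef_eq0.
have lcC u : lead_coef (toC u) = (lead_coef u)%:~R.
  by rewrite !lead_coefE szC coef_map.
have [rs hE] := closed_field_poly_normal (toC h).
have sz_rs : size rs = deg h.
  move/(congr1 (fun u : {poly algC} => size u)): hE.
  rewrite szC size_scale ?lcC ?intr_eq0 ?lead_coef_eq0 // size_prod_XsubC /deg.
  by move->.
have := landau rs (toC q * (lead_coef (toC h))%:P).
rewrite -[X in sqnorm X]mulrA mul_polyC -hE -rmorphM -fE lead_coefM lead_coefC !lcC -rmorphM.
rewrite -lead_coefM -fE prodrXl /sqnorm szC.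
rewrite (eq_bigr (fun j : 'I_(size f) => (f`_j ^+ 2)%:~R)) => [|j _]; last first.
  by rewrite coef_map sqZ.
rewrite -[\sum_(_ < _) _]rmorph_sum /= => HM.
have := coef_prod_XsubC_le rs i; rewrite sz_rs.
set M := \prod_(_ <- _) max1norm _ in HM * => Hi.
have M0 : 0 <= M by apply: prodr_ge0 => x _; apply: le_trans (max1norm_ge1 x).
have hi : `|(h`_i)%:~R : algC| <= `|(2 ^+ deg h * lead_coef h)%:~R| * M.
  rewrite -(coef_map (intr : int -> algC)) -/toC hE coefZ lcC rmorphM /= !normrM.
  rewrite [`|(2 ^+ _)%:~R|]ger0_norm ?ler0z ?exprn_ge0 // mulrAC mulrC.
  rewrite ler_wpM2r // (le_trans Hi) // ler_wpM2r //.
  rewrite rmorphXn /= -natrX ler_nat; exact: bin_le_exp2.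
set A := 2 ^+ deg h * lead_coef h in hi *.
rewrite -(ler_int algC) exprMn [X in X <= _]rmorphM [X in _ <= X]rmorphM /=.
rewrite !sqZ (le_trans (y := `|A%:~R| ^+ 2 * M ^+ 2 * `|(lead_coef f)%:~R| ^+ 2)) //.
  by rewrite ler_wpM2r ?exprn_ge0 // -exprMn lerXn2r ?nnegrE ?mulr_ge0.
by rewrite -mulrA ler_wpM2l ?exprn_ge0 // mulrC.
Qed.

(** * Greatest common divisors in Z[x] *)

Definition primitive_gcd (f g : {poly int}) : {poly int} :=
  zprimitive (gcdp f g).

Lemma lead_coef_zprimitive_gt0 (u : {poly int}) :
  u != 0 -> 0 < lead_coef (zprimitive u).
Proof. by move=> nz_u; rewrite -sgz_gt0 sgz_lead_primitive nz_u. Qed.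

Lemma dvdZX_dvdp (d u : {poly int}) : dvdZX d u -> d %| u.
Proof. by case=> q ->; rewrite dvdp_mull. Qed.

Lemma dvdZX_deg_le (d u : {poly int}) :
  u != 0 -> dvdZX d u -> (deg d <= deg u)%N.
Proof.
by move=> nz_u /dvdZX_dvdp/(dvdp_leq nz_u); rewrite /deg -!subn1; apply: leq_sub2r.
Qed.

Lemma dvdp_dvdZX (d u : {poly int}) : d %| u -> dvdZX (zprimitive d) u.
Proof. by case/dvdpP_int=> q ->; exists q; rewrite mulrC. Qed.

(** This makes the trial division decidable, [%|] being a boolean. *)
Lemma dvdZX_zprimitive (d u : {poly int}) : dvdZX (zprimitive d) u <-> d %| u.
Proof.
split=> [/dvdZX_dvdp|]; last exact: dvdp_dvdZX.
have [->|nz_d] := eqVneq d 0; first by rewrite zprimitive0.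
by rewrite {2}(zpolyEprim d) dvdpZl // zcontents_eq0.
Qed.

Lemma zprimitive_eqp (u v : {poly int}) :
  u %= v -> zprimitive u = zprimitive v.
Proof.
case/eqpP=> -[a b] /= /andP[nz_a nz_b] eq_uv.
by rewrite -(zprimitiveZ u nz_a) eq_uv zprimitiveZ.
Qed.

Lemma dvdZX_lead_coef (d u : {poly int}) :
  dvdZX d u -> (lead_coef d %| lead_coef u)%Z.
Proof. by case=> q ->; rewrite lead_coefM dvdz_mull. Qed.

Lemma primitive_gcd_dvdl (f g : {poly int}) : dvdZX (primitive_gcd f g) f.
Proof. by apply: dvdp_dvdZX; rewrite dvdp_gcdl. Qed.

Lemma primitive_gcd_dvdr (f g : {poly int}) : dvdZX (primitive_gcd f g) g.
Proof. by apply: dvdp_dvdZX; rewrite dvdp_gcdr. Qed.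

Lemma primitive_gcd_eq0 (f g : {poly int}) :
  (primitive_gcd f g == 0) = (f == 0) && (g == 0).
Proof. by rewrite zprimitive_eq0 gcdp_eq0. Qed.

Lemma primitive_gcd_max (f g d : {poly int}) :
  zprimitive d = d -> dvdZX d f -> dvdZX d g ->
  dvdZX d (primitive_gcd f g).
Proof.
move=> dE /dvdZX_dvdp df /dvdZX_dvdp dg.
have : d %| gcdp f g by rewrite dvdp_gcd df.
case/dvdpP_int=> q gE; exists (zprimitive q).
by rewrite /primitive_gcd gE zprimitiveM zprimitive_id dE mulrC.
Qed.

(** Gauss's lemma: contents and primitive parts are multiplicative, so
    divisibility in Z[x] splits into divisibility of contents and of primitive
    parts. *)
Lemma is_gcdZX_contents (f g : {poly int}) :
  is_gcdZX (gcdz (zcontents f) (zcontents g) *: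
            primitive_gcd (zprimitive f) (zprimitive g)) f g.
Proof.
set r := gcdz _ _; set h := primitive_gcd _ _.
have dvd_rh u : (r %| zcontents u)%Z -> dvdZX h (zprimitive u) -> dvdZX (r *: h) u.
  case/dvdzP=> s uE [q qE]; exists (s *: q).
  by rewrite [LHS]zpolyEprim uE qE -!mul_polyC polyCM; ring.
split; first by apply: dvd_rh; [apply: dvdz_gcdl | apply: primitive_gcd_dvdl].
  by apply: dvd_rh; [apply: dvdz_gcdr | apply: primitive_gcd_dvdr].
move=> d df dg.
have dvd_prim u : dvdZX d u -> dvdZX (zprimitive d) (zprimitive u).
  by case=> q ->; exists (zprimitive q); rewrite zprimitiveM.
have dvd_cont u : dvdZX d u -> (zcontents d %| zcontents u)%Z.
  by case=> q ->; rewrite zcontentsM dvdz_mull.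
have [q hE] := primitive_gcd_max (zprimitive_id d) (dvd_prim _ df) (dvd_prim _ dg).
have : (zcontents d %| r)%Z by rewrite dvdz_gcd !dvd_cont.
case/dvdzP=> s ->; exists (s *: q).
by rewrite {2}(zpolyEprim d) /h hE -!mul_polyC polyCM; ring.
Qed.

(** This is the Bezout relation of Q[x] with denominators cleared: pseudo-division
    yields it up to nonzero constants. *)
Lemma Bezout_primitive_gcd (f g : {poly int}) :
  exists c : int, c != 0 /\
    exists u v : {poly int}, c *: primitive_gcd f g = u * f + v * g.
Proof.
have /eqpP[[a b] /= /andP[nz_a nz_b] E] := egcdpE f g.
set u := (egcdp f g).1 in E; set v := (egcdp f g).2 in E.
have [gE0|nz_gcd] := eqVneq (gcdp f g) 0.
  exists 1; split=> //; exists 0, 0.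
  by rewrite /primitive_gcd gE0 zprimitive0 scaler0 !mul0r addr0.
exists (a * zcontents (gcdp f g)); split; first by rewrite mulf_neq0 ?zcontents_eq0.
exists (b *: u), (b *: v).
by rewrite -scalerA -zpolyEprim E scalerDr -!scalerAl.
Qed.

(** * Reduction modulo a prime *)

Lemma intr_Fp_eq0 (p : nat) (n : int) :
  prime p -> (n%:~R == 0 :> 'F_p) = (p %| n)%Z.
Proof. by move=> pr_p; rewrite (dvdz_pcharf (pchar_Fp pr_p)). Qed.

Lemma intr_Fp_neq0 (p : nat) (n : int) :
  prime p -> 0 < n -> n < p%:Z -> n%:~R != 0 :> 'F_p.
Proof.
move=> pr_p n_gt0 n_ltp; rewrite intr_Fp_eq0 //; apply/negP.
case: n n_gt0 n_ltp => [n|n] // n_gt0 n_ltp; rewrite dvdzE /= => /dvdn_leq.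
by move/(_ n_gt0); lia.
Qed.

(** The values of [sym_residue] lie between [-p/2] and [p/2], and [n] is the
    only representative of its class strictly inside this interval. *)
Lemma sym_residueK (p : nat) (n : int) :
  prime p -> 2 * `|n| < p%:Z -> sym_residue (n%:~R : 'F_p) = n.
Proof.
move=> pr_p lt_np; rewrite /sym_residue.
case: n lt_np => n lt_np.
  rewrite -[Posz n]/(n%:Z) -pmulrn val_Fp_nat // modn_small; last lia.
  by case: ifP => //; lia.
have -> : (Negz n)%:~R = (p - n.+1)%:R :> 'F_p.
  rewrite NegzE natrB ?pchar_Fp_0 //; last by lia.
  by rewrite sub0r mulrNz -pmulrn.
by rewrite val_Fp_nat // modn_small; last lia; case: ifP => //; lia.
Qed.

Lemma sym_residue0 (p : nat) : prime p -> sym_residue (0 : 'F_p) = 0.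
Proof.
move=> pr_p; have p_gt0 := prime_gt0 pr_p.
by rewrite -[0 : 'F_p]/(0%:~R) sym_residueK ?normr0 // mulr0; lia.
Qed.

Lemma reconstructK (p : nat) (k : {poly int}) :
  prime p -> (forall i, 2 * `|k`_i| < p%:Z) -> reconstruct (modp p k) = k.
Proof.
move=> pr_p k_small; apply/polyP=> i.
by rewrite /reconstruct coef_map_id0 ?sym_residue0 // coef_map sym_residueK.
Qed.

Lemma size_reconstruct (p : nat) (v : {poly 'F_p}) (w : int) :
  prime p -> 0 < w -> 2 * w < p%:Z -> lead_coef v = w%:~R ->
  size (reconstruct v) = size v.
Proof.
move=> pr_p w_gt0 lt_wp lcv; rewrite /reconstruct size_map_poly_id0 //.
by rewrite lcv sym_residueK ?gtr0_norm // gt_eqF.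
Qed.

Lemma size_modp (p : nat) (u : {poly int}) (w : int) :
  prime p -> 0 < w -> w < p%:Z -> (lead_coef u %| w)%Z ->
  size (modp p u) = size u.
Proof.
move=> pr_p w_gt0 w_ltp /dvdzP[s wE]; rewrite /modp size_map_poly_id0 //.
have := intr_Fp_neq0 pr_p w_gt0 w_ltp.
by rewrite wE rmorphM mulf_eq0 negb_or => /andP[].
Qed.

Lemma dvdp_modp (p : nat) (d u : {poly int}) :
  dvdZX d u -> modp p d %| modp p u.
Proof. by case=> q ->; rewrite /modp rmorphM dvdp_mull. Qed.

Section PrimitivePair.
Variables f g : {poly int}.
Hypothesis nz_f : f != 0.
Let w := lc_gcd f g.
Let h := primitive_gcd f g.

Lemma lc_gcd_gt0 : 0 < w.
Proof.
have := lead_coef_eq0 f; rewrite (negPf nz_f).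
by rewrite /w /lc_gcd /gcdz ltz_nat gcdn_gt0 !absz_gt0 => ->.
Qed.

Lemma primitive_gcd_neq0 : h != 0.
Proof. by rewrite primitive_gcd_eq0 (negPf nz_f). Qed.

Lemma primitive_gcd_lc_gt0 : 0 < lead_coef h.
Proof. by rewrite lead_coef_zprimitive_gt0 // gcdp_eq0 (negPf nz_f). Qed.

Lemma primitive_gcd_lc_dvd : (lead_coef h %| w)%Z.
Proof.
by rewrite dvdz_gcd !dvdZX_lead_coef //;
  [apply: primitive_gcd_dvdr | apply: primitive_gcd_dvdl].
Qed.

Section ModularGcd.
Variables (p : nat) (e : {poly 'F_p}).
Hypotheses (pr_p : prime p) (lt_wp : 2 * w < p%:Z).
Hypothesis eE : e %= gcdp (modp p f) (modp p g).

Let w_ltp : w < p%:Z.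
Proof. by apply: le_lt_trans lt_wp; rewrite ler_peMl // ltW ?lc_gcd_gt0. Qed.

Let size_hp : size (modp p h) = size h.
Proof. exact: size_modp pr_p lc_gcd_gt0 w_ltp primitive_gcd_lc_dvd. Qed.

Lemma modp_gcd_neq0 : e != 0.
Proof.
suff : gcdp (modp p f) (modp p g) != 0 by rewrite -!size_poly_eq0 (eqp_size eE).
rewrite gcdp_eq0; apply/negP=> /andP[/eqP fp0 /eqP gp0].
have lc0 u : modp p u = 0 -> (p %| lead_coef u)%Z.
  by move=> up0; rewrite -intr_Fp_eq0 // lead_coefE -coef_map -/(modp p u) up0 coef0.
have : (p %| w)%Z by rewrite dvdz_gcd !lc0.
by rewrite -intr_Fp_eq0 // (negPf (intr_Fp_neq0 pr_p lc_gcd_gt0 w_ltp)).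
Qed.

Lemma modp_primitive_gcd_dvd : modp p h %| e.
Proof.
by rewrite (eqp_dvdr _ eE) dvdp_gcd !dvdp_modp //;
  [apply: primitive_gcd_dvdr | apply: primitive_gcd_dvdl].
Qed.

Lemma size_primitive_gcd_le : (size h <= size e)%N.
Proof. by rewrite -size_hp dvdp_leq ?modp_gcd_neq0 ?modp_primitive_gcd_dvd. Qed.

(** Reducing the Bezout identity modulo a prime that does not divide [c] shows
    that [e] divides the reduction of [h], so that the degrees agree. *)
Lemma unlucky_prime_dvd (c : int) (u v : {poly int}) :
  c *: h = u * f + v * g -> size e != size h -> (p %| c)%Z.
Proof.
move=> cE; apply: contraNT; rewrite -intr_Fp_eq0 // => nz_c.
have : e %| modp p (c *: h).
  rewrite cE /modp rmorphD !rmorphM /= -/(modp p f) -/(modp p g).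
  by rewrite (eqp_dvdl _ eE) dvdp_add // dvdp_mull ?dvdp_gcdl ?dvdp_gcdr.
rewrite /modp map_polyZ /= dvdpZr // => /dvdp_leq.
rewrite -/(modp p h) -!size_poly_eq0 size_hp size_poly_eq0 primitive_gcd_neq0.
by move/(_ isT) => le_eh; rewrite eqn_leq le_eh size_primitive_gcd_le.
Qed.

(** When the sizes agree, both sides are scalar multiples of the reduction of [h]
    with the same leading coefficient. *)
Lemma lucky_prime_scaled (t : 'F_p) :
  size e = size h -> lead_coef (t *: e) = w%:~R ->
  t *: e = modp p ((w %/ lead_coef h)%Z *: h).
Proof.
move=> size_e lc_te.
have lch_p : lead_coef (modp p h) = (lead_coef h)%:~R.
  by rewrite !lead_coefE size_hp coef_map.
have nz_lch : (lead_coef h)%:~R != 0 :> 'F_p.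
  by rewrite -lch_p lead_coef_eq0 -size_poly_eq0 size_hp size_poly_eq0 primitive_gcd_neq0.
have := modp_primitive_gcd_dvd; move/dvdp_size_eqp; rewrite size_hp size_e eqxx.
move/esym; rewrite eqp_sym => /eqpfP eh.
rewrite /modp map_polyZ /= -/(modp p h) eh scalerA; congr (_ *: _).
apply: (mulIf nz_lch); rewrite -lch_p -lead_coefZ -scalerA -eh lc_te lch_p.
by rewrite -rmorphM /= divzK ?primitive_gcd_lc_dvd.
Qed.

Lemma size_candidate (t : 'F_p) :
  lead_coef (t *: e) = w%:~R ->
  size (zprimitive (reconstruct (t *: e))) = size e.
Proof.
move=> lc_te; rewrite size_zprimitive.
rewrite (size_reconstruct pr_p lc_gcd_gt0 lt_wp lc_te) size_scale //.
apply/eqP=> t0; move: lc_te; rewrite t0 scale0r lead_coef0 => /eqP.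
by rewrite eq_sym (negPf (intr_Fp_neq0 pr_p lc_gcd_gt0 w_ltp)).
Qed.

End ModularGcd.

Lemma common_divisor_size_eq (k : {poly int}) :
  dvdZX (zprimitive k) f -> dvdZX (zprimitive k) g ->
  (size h <= size (zprimitive k))%N -> zprimitive k = h.
Proof.
move=> /dvdZX_zprimitive kf /dvdZX_zprimitive kg le_hk.
apply: zprimitive_eqp; have kh : k %| gcdp f g by rewrite dvdp_gcd kf.
have nz_gcd : gcdp f g != 0 by rewrite gcdp_eq0 (negPf nz_f).
rewrite -dvdp_size_eqp // eqn_leq dvdp_leq //=.
by rewrite !size_zprimitive in le_hk.
Qed.

End PrimitivePair.

(** * Comparison with the coefficient bound *)

Section RealBounds.
Variable R : rcfType.
Implicit Types f g u h : {poly int}.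

Lemma norm2_ge0 u : 0 <= norm2 R u.
Proof. exact: sqrtr_ge0. Qed.

Lemma norm2_ge_lc u : 0 < lead_coef u -> (lead_coef u)%:~R <= norm2 R u.
Proof.
move=> lc_gt0; rewrite -[X in X <= _]gtr0_norm ?ltr0z // -sqrtr_sqr /norm2.
have : (0 < size u)%N by rewrite size_poly_gt0 -lead_coef_eq0 gt_eqF.
rewrite lead_coefE => size_gt0; apply: ler_wsqrtr.
case: (size u) size_gt0 => // n _; rewrite big_ord_recr /= lerDr.
by apply: sumr_ge0 => i _; rewrite sqr_ge0.
Qed.

Lemma lc_gcd_le_coef_bound f g :
  0 < lead_coef f -> 0 < lead_coef g ->
  (lc_gcd f g)%:~R <= coef_bound R f g.
Proof.
move=> f_gt0 g_gt0; rewrite /coef_bound.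
have w0 : 0 <= (lc_gcd f g)%:~R :> R by rewrite ler0z /lc_gcd /gcdz.
rewrite mulrAC ler_peMl // mulr_ege1 //.
  by rewrite exprn_ege1 // ler1n.
by rewrite le_min !ler_pdivlMr ?ltr0z // !mul1r !norm2_ge_lc.
Qed.

(** [mignotte] after taking square roots and dividing by the leading
    coefficients. *)
Lemma mignotte_norm2 h u i :
  h != 0 -> dvdZX h u -> 0 < lead_coef h -> 0 < lead_coef u ->
  `|(h`_i)%:~R| / (lead_coef h)%:~R
    <= 2 ^+ deg h * (norm2 R u / (lead_coef u)%:~R) :> R.
Proof.
move=> nz_h dvd_hu h_gt0 u_gt0.
rewrite ler_pdivrMr ?ltr0z // mulrA mulrAC ler_pdivlMr ?ltr0z // mulrAC.
have := mignotte i nz_h dvd_hu; rewrite -(ler_int R) [X in _ <= X]rmorphM.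
rewrite rmorph_sum /= (eq_bigr (fun j : 'I_(size u) => (u`_j)%:~R ^+ 2)); last first.
  by move=> j _; rewrite rmorphXn.
have sqE (a : int) : Num.sqrt (a ^+ 2)%:~R = `|a%:~R| :> R.
  by rewrite rmorphXn sqrtr_sqr.
move/ler_wsqrtr; rewrite sqrtrM ?ler0z ?sqr_ge0 // !sqE -/(norm2 R u).
rewrite !rmorphM /= !normrM rmorphXn /= [`|_ ^+ _|]ger0_norm ?exprn_ge0 //.
by rewrite !(@gtr0_norm _ (lead_coef _)%:~R) ?ltr0z.
Qed.

(** The coefficient bound is designed for this: [(w / lc h) h] is the polynomial
    that has to be reconstructed. *)
Lemma scaled_gcd_coef_bound f g h i :
  h != 0 -> 0 < lead_coef h -> 0 < lead_coef f -> 0 < lead_coef g ->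
  dvdZX h f -> dvdZX h g ->
  `|((lc_gcd f g %/ lead_coef h)%Z *: h)`_i|%:~R <= coef_bound R f g.
Proof.
move=> nz_h h_gt0 f_gt0 g_gt0 hf hg.
have deg_le u : 0 < lead_coef u -> dvdZX h u -> (deg h <= deg u)%N.
  by move=> u_gt0; apply: dvdZX_deg_le; rewrite -lead_coef_eq0 gt_eqF.
have dvd_lc : (lead_coef h %| lc_gcd f g)%Z by rewrite dvdz_gcd !dvdZX_lead_coef.
have w0 : 0 <= (lc_gcd f g)%:~R :> R by rewrite ler0z /lc_gcd /gcdz.
have nz_lc : (lead_coef h)%:~R != 0 :> R by rewrite intr_eq0 gt_eqF.
rewrite coefZ intr_norm rmorphM normrM /=.
have -> : (lc_gcd f g %/ lead_coef h)%Z%:~R = (lc_gcd f g)%:~R / (lead_coef h)%:~R :> R.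
  by apply: (mulIf nz_lc); rewrite -rmorphM /= divzK // mulfVK.
rewrite ger0_norm; last by rewrite divr_ge0 // ler0z ltW.
rewrite /coef_bound (mulrC (2 ^+ _)) -!mulrA ler_wpM2l // mulrC.
have bound u : 0 < lead_coef u -> dvdZX h u ->
    `|(h`_i)%:~R| / (lead_coef h)%:~R <=
      2 ^+ deg h * (norm2 R u / (lead_coef u)%:~R) :> R.
  by move=> *; exact: mignotte_norm2.
set ratio := Num.min _ _.
apply: (le_trans (y := 2 ^+ deg h * ratio)).
  by rewrite minr_pMr ?exprn_ge0 // le_min !bound.
rewrite ler_wpM2r //; last by rewrite ler_weXn2l ?ler1n // leq_min !deg_le.
by rewrite le_min !divr_ge0 ?norm2_ge0 ?ler0z ?(ltW f_gt0) ?(ltW g_gt0).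
Qed.

(** Even in a non-archimedean [R], the norm of an integer polynomial is below an
    integer, because [S <= (S + 1) ^+ 2] for the sum of squares [S].  Hence
    admissible primes exist. *)
Lemma coef_bound_lt_nat f g : 0 < lead_coef f ->
  exists B : nat, 2 * coef_bound R f g < B%:R.
Proof.
move=> f_gt0; pose S := \sum_(j < size f) f`_j ^+ 2.
have S_ge0 : 0 <= S by apply: sumr_ge0 => j _; rewrite sqr_ge0.
have nS : norm2 R f <= (S + 1)%:~R.
  have -> : norm2 R f = Num.sqrt (S%:~R).
    by rewrite /S rmorph_sum; congr Num.sqrt; apply: eq_bigr => j _; rewrite rmorphXn.
  rewrite -[X in _ <= X]ger0_norm ?ler0z; last by lia.
  by rewrite -sqrtr_sqr ler_wsqrtr // -rmorphXn ler_int; nia.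
pose B := 2 * (2 ^+ minn (deg f) (deg g) * lc_gcd f g * (S + 1)).
have w0 : 0 <= lc_gcd f g by [].
have B_ge0 : 0 <= B by rewrite !mulr_ge0 ?exprn_ge0 //; lia.
(* The successor makes the inequality strict. *)
exists `|B|%N.+1; apply: (le_lt_trans (y := B%:~R)); last first.
  by rewrite -natr1 -[X in X%:~R]gez0_abs // ltrDl ltr01.
rewrite /B !rmorphM rmorphXn /= ler_wpM2l // /coef_bound ler_wpM2l //.
  by rewrite mulr_ge0 ?exprn_ge0 // ler0z.
rewrite ge_min; apply/orP; left; apply: le_trans nS.
rewrite ler_pdivrMr ?ltr0z // ler_peMr ?norm2_ge0 //.
by rewrite -[1]/(1%:~R) ler_int; lia.
Qed.
End RealBounds.

(** * The transition system *)

Lemma count_lt (T : eqType) (a b : pred T) (x : T) (s : seq T) :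
  subpred a b -> x \in s -> b x -> ~~ a x -> (count a s < count b s)%N.
Proof.
move=> sub_ab xs bx nax; have := count_predC a (filter b s).
rewrite size_filter count_filter (eq_count (a2 := a)) => [<-|y /=]; last first.
  by case: (boolP (a y)) => // /sub_ab ->.
by rewrite -addn1 leq_add2l -has_count; apply/hasP; exists x; rewrite //= mem_filter bx.
Qed.

Lemma deg_eq_size (A B : nzRingType) (u : {poly A}) (v : {poly B}) :
  u != 0 -> v != 0 -> (deg u == deg v) = (size u == size v).
Proof.
rewrite -!size_poly_gt0 /deg; case: (size u) => // m _.
by case: (size v) => // n _; rewrite eqSS.
Qed.

Section Procedure.
Variables (R : rcfType) (f g : {poly int}).
Hypotheses (nz_f : f != 0) (nz_g : g != 0).
Let f1 := zprimitive f.
Let g1 := zprimitive g.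
Let h := primitive_gcd f1 g1.
Let w := lc_gcd f1 g1.

Let nz_f1 : f1 != 0. Proof. by rewrite zprimitive_eq0. Qed.
Let lc_f1 : 0 < lead_coef f1. Proof. exact: lead_coef_zprimitive_gt0. Qed.
Let lc_g1 : 0 < lead_coef g1. Proof. exact: lead_coef_zprimitive_gt0. Qed.
Let nz_h : h != 0. Proof. exact: primitive_gcd_neq0. Qed.
Let w_gt0 : 0 < w. Proof. exact: lc_gcd_gt0. Qed.

Definition admissible (p : nat) : Prop :=
  prime p /\ 2 * coef_bound R f1 g1 < p%:R.

Definition modular_gcd (p : nat) (e : {poly 'F_p}) : Prop :=
  e %= gcdp (modp p f1) (modp p g1).

Definition candidate (p : nat) (t : 'F_p) (e : {poly 'F_p}) : {poly int} :=
  zprimitive (reconstruct (t *: e)).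

Lemma admissible_gt_lc (p : nat) : admissible p -> 2 * w < p%:Z.
Proof.
case=> _ lt_p; rewrite -(ltr_int R) rmorphM /=; apply: le_lt_trans lt_p.
by rewrite ler_wpM2l // lc_gcd_le_coef_bound.
Qed.

Lemma deg_le_modular (p : nat) (e : {poly 'F_p}) :
  admissible p -> modular_gcd e -> (deg h <= deg e)%N.
Proof.
move=> adm eE; have [pr_p _] := adm.
have := size_primitive_gcd_le nz_f1 pr_p (admissible_gt_lc adm) eE.
by rewrite /deg -!subn1; apply: leq_sub2r.
Qed.

Lemma deg_eq_modular (p : nat) (e : {poly 'F_p}) :
  admissible p -> modular_gcd e -> (deg e == deg h) = (size e == size h).
Proof.
move=> adm eE; have [pr_p _] := adm; apply: deg_eq_size => //.
by have := modp_gcd_neq0 nz_f1 pr_p (admissible_gt_lc adm) eE.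
Qed.

Lemma lucky_candidate (p : nat) (e : {poly 'F_p}) (t : 'F_p) :
  admissible p -> modular_gcd e -> deg e = deg h ->
  lead_coef (t *: e) = w%:~R -> candidate t e = h.
Proof.
move=> adm eE /eqP; rewrite deg_eq_modular // => /eqP size_e lc_te.
have [pr_p lt_p] := adm; rewrite /candidate.
rewrite (lucky_prime_scaled nz_f1 pr_p (admissible_gt_lc adm) eE size_e lc_te).
have lch_gt0 : 0 < lead_coef h by apply: primitive_gcd_lc_gt0.
rewrite reconstructK //.
  rewrite zprimitiveZ ?zprimitive_id //.
  apply: contraTneq (w_gt0) => q0.
  by rewrite -[w](divzK (primitive_gcd_lc_dvd f1 g1)) q0 mul0r.
move=> i; rewrite -(ltr_int R) rmorphM /=; apply: le_lt_trans lt_p.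
rewrite ler_wpM2l // scaled_gcd_coef_bound //.
  exact: primitive_gcd_dvdl.
exact: primitive_gcd_dvdr.
Qed.

Lemma accepted_candidate (p : nat) (e : {poly 'F_p}) (t : 'F_p) :
  admissible p -> modular_gcd e -> lead_coef (t *: e) = w%:~R ->
  dvdZX (candidate t e) f1 -> dvdZX (candidate t e) g1 -> candidate t e = h.
Proof.
move=> adm eE lc_te df dg; have [pr_p _] := adm; have lt_wp := admissible_gt_lc adm.
apply: common_divisor_size_eq => //; rewrite -/(candidate t e).
by rewrite (size_candidate nz_f1 pr_p lt_wp lc_te) size_primitive_gcd_le.
Qed.

Lemma exists_normalizer (p : nat) (e : {poly 'F_p}) :
  admissible p -> modular_gcd e ->
  exists t : 'F_p, lead_coef (t *: e) = w%:~R.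
Proof.
move=> adm eE; have [pr_p _] := adm; exists (w%:~R / lead_coef e).
have nz_e := modp_gcd_neq0 nz_f1 pr_p (admissible_gt_lc adm) eE.
by rewrite lead_coefZ mulfVK ?lead_coef_eq0.
Qed.

Lemma exists_new_prime (used : seq nat) :
  exists p, admissible p /\ p \notin used.
Proof.
have [B lt_B] := coef_bound_lt_nat R g1 lc_f1.
have [p lt_p pr_p] := prime_above (B + \max_(q <- used) q).
exists p; split.
  by split=> //; apply: (lt_trans lt_B); rewrite ltr_nat; lia.
apply/negP=> p_used.
by have : (p <= \max_(q <- used) q)%N := leq_bigmax_seq p p_used isT; lia.
Qed.

(** What the algorithm maintains: the degree bound stays above [deg h] when a
    prime is chosen, and the data at hand come from an admissible prime. *)
Definition bpn_inv (c : config) : Prop :=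
  match c with
  | ChoosePrime D used => (deg h < D)%N
  | CompareDegree D used p e =>
      [/\ (deg h < D)%N, admissible p & modular_gcd e]
  | Normalize used p e => admissible p /\ modular_gcd e
  | TrialDivide m used d =>
      exists (p : nat) (e : {poly 'F_p}) (t : 'F_p),
        [/\ admissible p, modular_gcd e, lead_coef (t *: e) = w%:~R,
            m = deg e & d = candidate t e]
  | Output u => is_gcdZX u f g
  end.

Lemma bpn_inv_start : bpn_inv (bpn_start f g).
Proof.
rewrite /= ltnS leq_min !dvdZX_deg_le ?zprimitive_eq0 //.
  exact: primitive_gcd_dvdr.
exact: primitive_gcd_dvdl.
Qed.

(** The two transitions that need an argument leave the trial division: an
    accepted candidate is [h], and a rejected one comes from an unlucky prime, so
    that the new bound still exceeds [deg h]. *)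
Lemma bpn_inv_step (c c' : config) :
  bpn_inv c -> bpn_step R f g c c' -> bpn_inv c'.
Proof.
case: c => [D used|D used p e|used p e|m used d|u] //=.
- by move=> lt_D [p [e [pr_p _ lt_p eE ->]]]; split.
- by case=> lt_D adm eE ->; case: ifP.
- by case=> adm eE [t [lc_te ->]]; exists p, e, t.
case=> p [e [t [adm eE lc_te -> ->]]] [[[df dg] ->]|[ndvd ->]] /=.
  rewrite (accepted_candidate adm eE lc_te df dg); exact: is_gcdZX_contents.
rewrite ltn_neqAle deg_le_modular // andbT; apply/eqP=> /esym deg_e; apply: ndvd.
rewrite (lucky_candidate adm eE deg_e lc_te).
by split; [apply: primitive_gcd_dvdl | apply: primitive_gcd_dvdr].
Qed.

Lemma bpn_progress (c : config) :
  bpn_inv c -> (exists u, c = Output u) \/ exists c', bpn_step R f g c c'.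
Proof.
case: c => [D used|D used p e|used p e|m used d|u]; last by left; exists u.
- move=> _; right; have [p [[pr_p lt_p] new_p]] := exists_new_prime used.
  by do 3!eexists; split; eauto; apply: eqpxx.
- by move=> _; right; eexists.
- case=> adm eE; right; have [t lc_te] := exists_normalizer adm eE.
  by eexists; exists t; split.
case=> p [e [t [_ _ _ _ ->]]]; right.
case: (boolP ((reconstruct (t *: e) %| f1) && (reconstruct (t *: e) %| g1))).
  by case/andP=> df dg; eexists; left; split=> //; split; apply: dvdp_dvdZX.
move=> ndvd; eexists; right; split=> // -[/dvdZX_zprimitive df /dvdZX_zprimitive dg].
by rewrite df dg in ndvd.
Qed.

Section Termination.
Variable c0 : int.
Hypothesis nz_c0 : c0 != 0.
Hypothesis Bezout_c0 :
  exists u v : {poly int}, c0 *: h = u * f1 + v * g1.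

(** Unlucky primes are among the prime divisors of [c0]. *)
Definition unlucky_left (used : seq nat) : nat :=
  count (fun p => p \notin used) (primes `|c0|).

(** With a lucky prime three more steps lead to the output.  With an unlucky
    one the procedure may go through the loop again, but one unlucky prime fewer
    is left, which pays for the three steps back to the choice of a prime. *)
Definition bpn_measure (c : config) : nat :=
  match c with
  | ChoosePrime _ used => 4 * unlucky_left used + 4
  | CompareDegree _ used _ e =>
      if deg e == deg h then 3 else 4 * unlucky_left used + 7
  | Normalize used _ e =>
      if deg e == deg h then 2 else 4 * unlucky_left used + 6
  | TrialDivide m used _ =>
      if m == deg h then 1 else 4 * unlucky_left used + 5
  | Output _ => 0
  end.

Lemma unlucky_left_lt (p : nat) (used : seq nat) :
  prime p -> (p %| c0)%Z -> p \notin used ->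
  (unlucky_left (p :: used) < unlucky_left used)%N.
Proof.
move=> pr_p p_c0 new_p; apply: (@count_lt _ _ _ p) => [q||//|].
- by rewrite in_cons negb_or => /andP[].
- by rewrite mem_primes pr_p absz_gt0 nz_c0 -[(_ %| _)%N]/((p %| c0)%Z).
by rewrite in_cons eqxx.
Qed.

Lemma bpn_measure_step (c c' : config) :
  bpn_inv c -> bpn_step R f g c c' -> (bpn_measure c' < bpn_measure c)%N.
Proof.
case: c => [D used|D used p e|used p e|m used d|u] //=.
- move=> _ [p [e [pr_p new_p lt_p eE ->]]] /=.
  have adm : admissible p by [].
  case: ifP => [|/negbT]; first by lia.
  rewrite deg_eq_modular // => unlucky; have [u [v cE]] := Bezout_c0.
  have p_c0 := unlucky_prime_dvd nz_f1 pr_p (admissible_gt_lc adm) eE cE unlucky.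
  by have := unlucky_left_lt pr_p p_c0 new_p; lia.
- case=> lt_D adm eE ->; case: (leqP D (deg e)) => le_D /=.
    by case: eqP => [deg_e|_]; lia.
  by case: ifP; lia.
- by case=> adm eE [t [_ ->]] /=; case: ifP; lia.
case=> p [e [t [adm eE lc_te -> ->]]] [[_ ->]|[ndvd ->]] /=.
  by case: ifP; lia.
case: eqP => [deg_e|_]; last by lia.
case: ndvd; rewrite (lucky_candidate adm eE deg_e lc_te).
by split; [apply: primitive_gcd_dvdl | apply: primitive_gcd_dvdr].
Qed.

End Termination.

Lemma bpn_inv_reachable (c : config) : bpn_reachable R f g c -> bpn_inv c.
Proof.
move=> reach_c; have {reach_c} := clos_rt_rtn1 _ _ _ _ reach_c.
elim=> [|c1 c2 step12 _ inv1]; first exact: bpn_inv_start.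
by apply: bpn_inv_step step12.
Qed.

Lemma bpn_no_infinite_run (run : nat -> config) :
  run 0%N = bpn_start f g -> ~ forall i, bpn_step R f g (run i) (run i.+1).
Proof.
move=> run0 step; have [c0 [nz_c0 Bezout_c0]] := Bezout_primitive_gcd f1 g1.
have inv i : bpn_inv (run i).
  elim: i => [|i IH]; first by rewrite run0; apply: bpn_inv_start.
  exact: bpn_inv_step (step i).
have bound i : (bpn_measure c0 (run i) + i <= bpn_measure c0 (run 0))%N.
  elim: i => [|i IH]; first by rewrite addn0.
  by have := bpn_measure_step nz_c0 Bezout_c0 (inv i) (step i); lia.
by have := bound (bpn_measure c0 (run 0%N)).+1; lia.
Qed.

End Procedure.

Theorem mainTheorem1 (R : rcfType) (f g : {poly int})
    (hf : f != 0) (hg : g != 0) :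
  (* no execution runs forever *)
  (~ exists run : nat -> config,
       run 0%N = bpn_start f g /\
       forall i : nat, bpn_step R f g (run i) (run i.+1)) /\
  (* an execution that cannot be continued has output a gcd *)
  (forall c : config,
     bpn_reachable R f g c ->
     (forall c' : config, ~ bpn_step R f g c c') ->
     exists h : {poly int}, c = Output h /\ is_gcdZX h f g).
Proof.
split=> [[run [run0 step]]|c reach_c stuck].
  exact: (bpn_no_infinite_run hf hg run0 step).
have inv_c := bpn_inv_reachable hf hg reach_c.
have [[u cE]|[c' step]] := bpn_progress hf hg inv_c; last by case: (stuck c').
by exists u; rewrite cE in inv_c.
Qed.
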